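(* Let $n\ge1$ and let $(v_0,v)\in\mathbb{R}\times\mathbb{R}^n$ be such that $\mathrm{E\text{-}CG}(v_0,v)\in\mathcal{F}_2$. Then the inequality defined by $\mathrm{E\text{-}CG}(v_0,v)$ is implied by a nonnegative combination of at most two Boros--Hammer inequalities; that is, there are two (not necessarily distinct) Boros--Hammer inequalities $\ell_1(x,X)\ge 0$ and $\ell_2(x,X)\ge0$ and multipliers $\lambda_1,\lambda_2\ge 0$ such that every $(x,X)\in\mathbb{R}^{n+\binom n2}$ with $\lambda_1\ell_1(x,X)+\lambda_2\ell_2(x,X)\ge 0$ satisfies the inequality defined by $\mathrm{E\text{-}CG}(v_0,v)$.
   Context: For $v_0\in\mathbb{R}$ and $v\in\mathbb{R}^n$, $\mathrm{E\text{-}CG}(v_0,v)=(\alpha,\beta,\gamma)\in\mathbb{R}^{n+\binom n2+1}$ is the coefficient vector with $\alpha_i=\lceil v_i^2+2v_iv_0\rceil$ for $i\in\{1,\dots,n\}$, $\beta_{ij}=\lceil 2v_iv_j\rceil$ for $1\le i<j\le n$, and $\gamma=\lfloor v_0^2\rfloor$. The inequality it defines is $\sum_{i<j}\beta_{ij}X_{i,j}+\sum_i\alpha_ix_i+\gamma\ge 0$ in variables $x=(x_i)_{1\le i\le n}$, $X=(X_{i,j})_{1\le i<j\le n}$. $\mathcal{F}_2=\{\mathrm{E\text{-}CG}(v_0,v): v_0\in\mathbb{R},\ v\in\mathbb{R}^n,\ v_i^2\in\mathbb{Z}\ \forall i,\ 2v_iv_j\in\mathbb{Z}\ \forall i\ne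 j,\ 2v_iv_0\in\mathbb{Z}\ \forall i\}$. A Boros--Hammer (BH) inequality is an inequality of the form $$\sum_{1\le i<j\le n}2w_iw_jX_{i,j}+\sum_{i=1}^n w_i(w_i+2w_0-1)x_i+w_0(w_0-1)\ge 0$$ for some $(w_0,w)\in\mathbb{Z}^{n+1}$. *)

(* Defs.v *)
From mathcomp Require Import all_boot all_order all_algebra.
From mathcomp Require Import boolp classical_sets reals.

Set Implicit Arguments.
Unset Strict Implicit.
Unset Printing Implicit Defensive.

Import Order.TTheory GRing.Theory Num.Theory.
Local Open Scope ring_scope.

(* The pairs (i, j) with i < j, which index the 'C(n, 2) variables X_(i, j). *)
Notation opair n := {p : 'I_n * 'I_n | (p.1 < p.2)%N}.

Definition fst_idx (n : nat) (p : opair n) : 'I_n := (val p).1.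
Definition snd_idx (n : nat) (p : opair n) : 'I_n := (val p).2.

(* (alpha, beta, gamma) in R^(n + 'C(n, 2) + 1). *)
Definition coefs (R : realType) (n : nat) : Type :=
  ('rV[R]_n * {ffun opair n -> R} * R)%type.

(* The affine form (x, X) |-> beta . X + alpha . x + gamma. *)
Definition lhs (R : realType) (n : nat) (c : coefs R n)
    (x : 'rV[R]_n) (X : {ffun opair n -> R}) : R :=
  let: (alpha, beta, gamma) := c in
  \sum_(p : opair n) beta p * X p + \sum_(i < n) alpha 0 i * x 0 i + gamma.

Definition satisfies (R : realType) (n : nat) (c : coefs R n)
    (x : 'rV[R]_n) (X : {ffun opair n -> R}) : Prop :=
  0 <= lhs c x X.

Definition ECG (R : realType) (n : nat) (v0 : R) (v : 'rV[R]_n) : coefs R n :=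
  (\row_(i < n) (Num.ceil (v 0 i ^+ 2 + 2 * v 0 i * v0))%:~R,
   [ffun p : opair n =>
      (Num.ceil (2 * v 0 (fst_idx p) * v 0 (snd_idx p)))%:~R],
   (Num.floor (v0 ^+ 2))%:~R).

Definition F2 (R : realType) (n : nat) : set (coefs R n) :=
  [set c | exists (v0 : R) (v : 'rV[R]_n),
     [/\ forall i : 'I_n, v 0 i ^+ 2 \is a Num.int,
         forall i j : 'I_n, i != j -> 2 * v 0 i * v 0 j \is a Num.int,
         forall i : 'I_n, 2 * v 0 i * v0 \is a Num.int
       & c = ECG v0 v]]%classic.
Arguments F2 : clear implicits.

Definition BH (R : realType) (n : nat) (w0 : int) (w : 'rV[int]_n) :
    coefs R n :=
  (\row_(i < n) (w 0 i * (w 0 i + 2 * w0 - 1))%:~R,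
   [ffun p : opair n => (2 * w 0 (fst_idx p) * w 0 (snd_idx p))%:~R],
   (w0 * (w0 - 1))%:~R).
Arguments BH : clear implicits.

Definition is_BH (R : realType) (n : nat) (c : coefs R n) : Prop :=
  exists (w0 : int) (w : 'rV[int]_n), c = BH R n w0 w.

(* Main.v *)
Require Import Defs.
From mathcomp Require Import all_boot all_order all_algebra.
From mathcomp Require Import boolp classical_sets reals.
From mathcomp Require Import ring lra.

Set Implicit Arguments.
Unset Strict Implicit.
Unset Printing Implicit Defensive.

Import Order.TTheory GRing.Theory Num.Theory.
Local Open Scope ring_scope.

(** Write Q(u) = sum_(i<j) 2 u_i u_j X_ij + sum_i u_i^2 x_i and
    L(u) = sum_i u_i x_i.  Under the integrality hypotheses the inequality of
    E-CG(v0, v) is Q(v) + 2 v0 L(v) + floor(v0^2) >= 0, and the Boros--Hammer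
    inequality of (w0, w) is Q(w) + (2 w0 - 1) L(w) + w0 (w0 - 1) >= 0.

    The entries of v generate a subgroup of the reals all of whose elements
    have an integer square.  Such a group is discrete, hence cyclic
    ([int_square_group_cyclic]), so v = r t with t an integer vector; moreover
    r^2 and 2 r v0 are integers ([common_generator]).  Let w0 r be an
    integer multiple of r nearest to v0, and put e = 2 r v0 - 2 w0 r^2, so that
    |e| <= r^2 ([nearest_multiple]).  The multipliers (r^2 - e) / 2 and (r^2 + e) / 2 are
    nonnegative, and they combine the Boros--Hammer forms of (w0, t) and
    (w0 + 1, t) into
      r^2 Q(t) + 2 r v0 L(t) + w0 (2 r v0 - w0 r^2)
        = Q(v) + 2 v0 L(v) + w0 (2 r v0 - w0 r^2).
    The last constant is an integer and equals v0^2 - (v0 - w0 r)^2, so it is at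
    most floor(v0^2): the combination is dominated by the E-CG form. *)

Section CyclicGroups.
Variable R : realType.
Implicit Types (G : R -> Prop) (x y r : R).

Lemma intmul_closed G :
  G 0 -> (forall x y, G x -> G y -> G (x - y)) ->
  forall (k : int) x, G x -> G (k%:~R * x).
Proof.
move=> G0 GB.
have GD x y : G x -> G y -> G (x + y).
  by move=> Gx Gy; rewrite -(opprK y) -(sub0r y); apply/GB => //; apply: GB.
have Gn (n : nat) x : G x -> G (n%:R * x).
  move=> Gx; elim: n => [|n IHn]; first by rewrite mul0r.
  by rewrite -natr1 mulrDl mul1r; apply: GD.
move=> [n|n] x Gx; first exact: Gn.
by rewrite NegzE mulrNz mulNr -sub0r; apply: GB => //; apply: Gn.
Qed.

(** The squares of the nonzero elements are positive integers, so some nonzero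
    element [r] has least square.  Subtracting from [x] a suitable multiple of
    [r] leaves an element of the group smaller than [r] in absolute value, hence
    zero. *)
Lemma int_square_group_cyclic G :
  G 0 -> (forall x y, G x -> G y -> G (x - y)) ->
  (forall x, G x -> x ^+ 2 \is a Num.int) ->
  exists2 r, G r & forall x, G x -> exists k : int, x = k%:~R * r.
Proof.
move=> G0 GB Gsq.
have [[x0 Gx0 x0N0]|noN0] := pselect (exists2 x, G x & x != 0); last first.
  exists 0 => // x Gx; exists 0; rewrite mul0r.
  by apply/eqP; apply: contra_notT noN0 => xN0; exists x.
have Gnat x : G x -> exists m : nat, x ^+ 2 = m%:R.
  by move=> /Gsq sqx; apply/natrP; rewrite natrEint sqx sqr_ge0.
pose sq_of_G m := `[< exists x, [/\ G x, x != 0 & x ^+ 2 = m%:R] >].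
have ex_sq : exists m, sq_of_G m.
  by have [m x0m] := Gnat _ Gx0; exists m; apply/asboolP; exists x0.
have [m /asboolP[r [Gr rN0 r2m]] m_min] := ex_minnP ex_sq.
exists r => // x Gx; exists (Num.floor (x / r)).
set k := Num.floor _; set y := x - k%:~R * r.
have Gy : G y by apply: (GB _ _ Gx); apply: intmul_closed.
have y2_lt : y ^+ 2 < r ^+ 2.
  have yE : y = (x / r - k%:~R) * r by rewrite /y; field.
  have q_ge0 : 0 <= x / r - k%:~R by rewrite subr_ge0 floor_le.
  have q_lt1 : x / r - k%:~R < 1.
    by rewrite ltrBlDl -(intrD _ _ 1) floorD1_gt.
  by rewrite yE exprMn gtr_pMl ?exprn_even_gt0 // expr_lt1.
apply/eqP; rewrite -subr_eq0 -/y; apply: contraTT y2_lt => yN0.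
have [p y2p] := Gnat _ Gy.
rewrite -leNgt r2m y2p ler_nat; apply: m_min.
by apply/asboolP; exists y.
Qed.

End CyclicGroups.

(** The cyclic group theorem is applied to the elements [x] with an integer
    square for which [2 * x * y] is an integer for every [y] in [S], where [S]
    consists of the [y] with all [2 * y * v 0 i] integers.  This group is a
    bidual of [v]: it contains the entries of [v], since they and [v0] lie in
    [S], and it is contained in [S].  The inclusion gives the integrality of
    [2 * x * y] within the group, which makes the squares of differences
    integers. *)
Lemma common_generator (R : realType) (n : nat) (v0 : R) (v : 'rV[R]_n) :
    (forall i, v 0 i ^+ 2 \is a Num.int) ->
    (forall i j, i != j -> 2 * v 0 i * v 0 j \is a Num.int) ->
    (forall i, 2 * v 0 i * v0 \is a Num.int) ->
  exists (r : R) (t : 'rV[int]_n),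
    [/\ v = r *: map_mx intr t, r ^+ 2 \is a Num.int
      & 2 * r * v0 \is a Num.int].
Proof.
move=> v_sq vv vv0.
pose S y := forall i, 2 * y * v 0 i \is a Num.int.
pose G x := x ^+ 2 \is a Num.int /\ forall y, S y -> 2 * x * y \is a Num.int.
have Sv0 : S v0 by move=> i; rewrite mulrAC.
have Sv i : S (v 0 i).
  move=> j; have [->|/vv//] := eqVneq i j.
  by rewrite -mulrA -expr2 rpredM ?rpred_nat.
have Gv i : G (v 0 i) by split=> // y /(_ i); rewrite mulrAC.
have GS x : G x -> S x by move=> [_ Gx] i; apply: Gx.
have G0 : G 0 by split=> [|y _]; rewrite ?expr0n ?mulr0 ?mul0r rpred0.
have GB x y : G x -> G y -> G (x - y).
  move=> Gx Gy; have [[sqx Gx2] [sqy Gy2]] := (Gx, Gy); split=> [|z Sz].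
    have -> : (x - y) ^+ 2 = x ^+ 2 - 2 * x * y + y ^+ 2 by ring.
    by rewrite rpredD // rpredB // Gx2 //; apply: GS.
  by rewrite mulrBr mulrBl rpredB ?Gx2 ?Gy2.
have [r [r_sq Gr] r_gen] := int_square_group_cyclic G0 GB (fun x => @proj1 _ _).
have [t vE] := choice (fun i => r_gen _ (Gv i)).
exists r, (\row_i t i); split=> //; last exact: Gr.
by apply/rowP => i; rewrite !mxE mulrC.
Qed.

Section Forms.
Variables (R : realType) (n : nat).
Implicit Types (u x : 'rV[R]_n) (X : {ffun opair n -> R}).

Definition quad_form u x X : R :=
  \sum_(p : opair n) 2 * u 0 (fst_idx p) * u 0 (snd_idx p) * X p
  + \sum_(i < n) u 0 i ^+ 2 * x 0 i.

Definition lin_form u x : R := \sum_(i < n) u 0 i * x 0 i.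

Lemma quad_formZ r u x X : quad_form (r *: u) x X = r ^+ 2 * quad_form u x X.
Proof.
rewrite /quad_form mulrDr !mulr_sumr.
by congr (_ + _); apply: eq_bigr => i _; rewrite !mxE; ring.
Qed.

Lemma lin_formZ r u x : lin_form (r *: u) x = r * lin_form u x.
Proof.
by rewrite /lin_form mulr_sumr; apply: eq_bigr => i _; rewrite mxE mulrA.
Qed.

Lemma lhs_BH (w0 : int) (w : 'rV[int]_n) x X :
  lhs (BH R n w0 w) x X =
    quad_form (map_mx intr w) x X
    + (2 * w0%:~R - 1) * lin_form (map_mx intr w) x
    + w0%:~R * (w0%:~R - 1).
Proof.
rewrite /lhs /BH /quad_form /lin_form mulr_sumr.
congr (_ + _); last by rewrite intrM intrB.
rewrite -addrA -big_split /=; congr (_ + _); apply: eq_bigr => k _.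
  by rewrite ffunE !mxE !intrM.
by rewrite !mxE !(intrM, intrD, intrB); ring.
Qed.

Lemma lhs_ECG (v0 : R) (v : 'rV[R]_n) x X :
    (forall i, v 0 i ^+ 2 \is a Num.int) ->
    (forall i j, i != j -> 2 * v 0 i * v 0 j \is a Num.int) ->
    (forall i, 2 * v 0 i * v0 \is a Num.int) ->
  lhs (ECG v0 v) x X =
    quad_form v x X + 2 * v0 * lin_form v x + (Num.floor (v0 ^+ 2))%:~R.
Proof.
move=> v_sq vv vv0.
rewrite /lhs /ECG /quad_form /lin_form mulr_sumr.
congr (_ + _).
rewrite -addrA -big_split /=; congr (_ + _); apply: eq_bigr => k _.
  rewrite ffunE ceilK // vv //.
  by rewrite -(inj_eq val_inj) neq_ltn (valP k).
by rewrite !mxE ceilK ?rpredD //; ring.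
Qed.

End Forms.

(** For [r != 0], dividing by [2 * r ^+ 2] turns the bound into
    [`|a / r - w0| <= 1 / 2], a rounding of [a / r].  For [r = 0] both sides of
    the bound vanish, whatever [w0] is. *)
Lemma nearest_multiple (R : realType) (r a : R) :
  exists w0 : int, `|2 * r * a - 2 * w0%:~R * r ^+ 2| <= r ^+ 2.
Proof.
exists (Num.floor (a / r + 2^-1)); set w0 := Num.floor _.
have ra : r * a = r ^+ 2 * (a / r).
  by have [->|rN0] := eqVneq r 0; [rewrite expr0n !mul0r | field].
have w0_le : w0%:~R <= a / r + 2^-1 by apply: floor_le.
have w0_gt : a / r + 2^-1 < w0%:~R + 1 by rewrite -(intrD _ _ 1) floorD1_gt.
have -> : 2 * r * a - 2 * w0%:~R * r ^+ 2 = r ^+ 2 * (2 * (a / r - w0%:~R)).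
  by rewrite -mulrA ra; ring.
rewrite normrM ger0_norm ?sqr_ge0 // ler_piMr ?sqr_ge0 //.
by rewrite ler_norml; apply/andP; split; lra.
Qed.

Theorem lemma4 (R : realType) (n : nat) (hn : (1 <= n)%N)
    (v0 : R) (v : 'rV[R]_n) (hF2 : F2 R n (ECG v0 v)) :
  exists (l1 l2 : coefs R n) (lambda1 lambda2 : R),
    [/\ is_BH l1, is_BH l2, 0 <= lambda1, 0 <= lambda2
      & forall (x : 'rV[R]_n) (X : {ffun opair n -> R}),
          0 <= lambda1 * lhs l1 x X + lambda2 * lhs l2 x X ->
          satisfies (ECG v0 v) x X].
Proof.
(* The integrality conditions hold for some pair with the same E-CG vector,
   which need not be (v0, v) itself. *)
case: hF2 => a [u [u_sq uu ua ->]].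
have [r [t [uE r_int ra_int]]] := common_generator u_sq uu ua.
have [w0] := nearest_multiple r a.
set e := _ - _; rewrite ler_norml => /andP[e_ge e_le].
exists (BH R n w0 t), (BH R n (w0 + 1) t), ((r ^+ 2 - e) / 2), ((r ^+ 2 + e) / 2).
split; [by exists w0, t | by exists (w0 + 1), t | lra | lra |].
move=> x X; rewrite /satisfies lhs_ECG // uE quad_formZ lin_formZ !lhs_BH.
set c := w0%:~R * (2 * r * a - w0%:~R * r ^+ 2).
have c_le : c <= (Num.floor (a ^+ 2))%:~R.
  have c_int : c \is a Num.int.
    by rewrite rpredM ?intr_int // rpredB // rpredM ?intr_int.
  have ca : c <= a ^+ 2.
    have -> : c = a ^+ 2 - (a - w0%:~R * r) ^+ 2 by rewrite /c; ring.
    by rewrite gerBl sqr_ge0.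
  by rewrite -(floorK c_int) ler_int le_floor.
move=> /le_trans; apply; rewrite -lerBlDl; apply: le_trans c_le.
by rewrite le_eqVlt; apply/orP; left; apply/eqP; rewrite /c /e intrD; field.
Qed.
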